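(* Let $m$ be a positive integer, let $\alpha>0$, let $\lambda$ be a nonzero real number, and let $X$ be a Poisson random variable with parameter $\alpha$. Then for every integer $n\ge0$, $$\phi_{n,\frac{\lambda}{m}}(\alpha)=E\big[(X)_{n,\frac{\lambda}{m}}\big]=\sum_{k=0}^nC_k(0;\alpha)(-1)^k\,S_{2,\frac{\lambda}{m}}(n,k).$$
   Context: For real $x$ and nonzero real $\mu$, $(x)_{0,\mu}=1$, $(x)_{n,\mu}=x(x-\mu)\cdots(x-(n-1)\mu)$ for $n\ge1$; $(x)_0=1$, $(x)_k=x(x-1)\cdots(x-k+1)$. The degenerate Stirling numbers of the second kind are defined by $(x)_{n,\mu}=\sum_{k=0}^nS_{2,\mu}(n,k)(x)_k$, and the degenerate Bell polynomials by $\phi_{n,\mu}(x)=\sum_{k=0}^nS_{2,\mu}(n,k)x^k$. The Charlier polynomials $C_n(x;\alpha)$ are defined by $e^{-\alpha t}(1+t)^x=\sum_{n\ge0}C_n(x;\alpha)\frac{t^n}{n!}$. *)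

(* Defs.v *)
From mathcomp Require Import all_boot all_order all_algebra.
From mathcomp Require Import all_classical all_reals all_analysis.
From mathcomp Require Import ring lra.
Set Implicit Arguments.
Unset Strict Implicit.
Unset Printing Implicit Defensive.
Import Order.TTheory GRing.Theory Num.Theory.
Import numFieldNormedType.Exports.
Local Open Scope classical_set_scope.
Local Open Scope ring_scope.

(* [dffact mu n x] is (x)_{n,mu} = x (x - mu) ... (x - (n - 1) mu); the ordinary
   falling factorial (x)_k is [dffact 1 k x]. *)
Definition dffact {R : realType} (mu : R) (n : nat) (x : R) : R :=
  \prod_(i < n) (x - i%:R * mu).

(* The expansion only determines the coefficients of index at most [n]; the
   others are fixed to be 0.  Existence and uniqueness are [is_dstirling2P] and
   [is_dstirling2_uniq]. *)
Definition is_dstirling2 {R : realType} (mu : R) (n : nat) (s : nat -> R) : Prop :=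
  (forall x : R, dffact mu n x = \sum_(k < n.+1) s k * dffact 1 k x) /\
  (forall k : nat, (n < k)%N -> s k = 0).

Definition dstirling2 {R : realType} (mu : R) (n k : nat) : R :=
  get [set s : nat -> R | is_dstirling2 mu n s] k.

Definition dbell {R : realType} (mu : R) (n : nat) (x : R) : R :=
  \sum_(k < n.+1) dstirling2 mu n k * x ^+ k.

(* The generating function identity is read as an identity of convergent power
   series for [t] in a neighbourhood of 0; existence and uniqueness of the
   coefficients are [is_charlierP] and [is_charlier_uniq]. *)
Definition is_charlier {R : realType} (x alpha : R) (c : nat -> R) : Prop :=
  \forall t \near (0 : R),
    pseries (fun n => c n / n`!%:R) t @ \oo --> expR (- alpha * t) * (1 + t) `^ x.

Definition charlier {R : realType} (n : nat) (x alpha : R) : R :=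
  get [set c : nat -> R | is_charlier x alpha c] n.

Definition poisson_distributed {R : realType} {d : measure_display}
    {T : measurableType d} (P : probability T R) (X : {RV P >-> R}) (alpha : R) :
    Prop :=
  forall k : nat, pmf X k%:R = poisson_pmf alpha k.

Lemma dffactS {R : realType} (mu : R) n x :
  dffact mu n.+1 x = dffact mu n x * (x - n%:R * mu).
Proof. by rewrite /dffact big_ord_recr. Qed.

Lemma dffact1_small {R : realType} (j k : nat) :
  (j < k)%N -> dffact 1 k (j%:R : R) = 0.
Proof.
by move=> jk; rewrite /dffact (bigD1 (Ordinal jk))//= mulr1 subrr mul0r.
Qed.

Lemma dffact1_diag_neq0 {R : realType} (j : nat) : dffact 1 j (j%:R : R) != 0.
Proof.
apply/prodf_neq0 => i _; rewrite mulr1 subr_eq0 eqr_nat gtn_eqF//.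
Qed.

Lemma is_dstirling2_ex {R : realType} (mu : R) n : exists s, is_dstirling2 mu n s.
Proof.
elim: n => [|n [s [sE s0]]].
  exists (fun k => (k == 0%N)%:R); split=> [x|[]//].
  by rewrite big_ord1 /dffact !big_ord0 mulr1.
exists (fun k => (if k is j.+1 then s j else 0) + (k%:R - n%:R * mu) * s k).
split=> [x|[//|k nk]]; last by rewrite !s0 ?mulr0 ?addr0// ltnW.
rewrite dffactS sE mulr_suml.
under [RHS]eq_bigr do rewrite mulrDl.
rewrite big_split/= [X in _ = X + _]big_ord_recl/= mul0r add0r.
rewrite [X in _ = _ + X]big_ord_recr/= s0// mulr0 mul0r addr0 -big_split/=.
apply: eq_bigr => k _; rewrite /bump/= add1n dffactS; ring.
Qed.

Lemma is_dstirling2P {R : realType} (mu : R) n :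
  is_dstirling2 mu n (dstirling2 mu n).
Proof. by case: (is_dstirling2_ex mu n) => s; exact: getI. Qed.

Lemma is_dstirling2_uniq {R : realType} (mu : R) n s1 s2 :
  is_dstirling2 mu n s1 -> is_dstirling2 mu n s2 -> s1 = s2.
Proof.
move=> [s1E s10] [s2E s20]; apply/funext.
elim/ltn_ind => k IH; have [kn|nk] := leqP k n; last by rewrite s10// s20.
have := s1E k%:R; rewrite s2E => /esym.
have kn' : (k < n.+1)%N by [].
rewrite (bigD1 (Ordinal kn'))//= [RHS](bigD1 (Ordinal kn'))//=.
rewrite (eq_bigr (fun i : 'I__ => s2 i * dffact 1 i k%:R)) => [|i ik].
  by move/addIr/mulIf; apply; exact: dffact1_diag_neq0.
have [/IH->//|ki] := ltnP i k.
by rewrite dffact1_small ?mulr0// ltn_neqAle ki andbT eq_sym.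
Qed.

Lemma is_cvg_pseries_bound {R : realType} (c : R^nat) (A B t : R) : 0 <= B ->
  (forall n, `|c n| <= A * B ^+ n) -> `|t| * B < 1 -> cvgn (pseries c t).
Proof.
move=> B0 cB tB; apply: normed_cvg.
have A0 : 0 <= A by have := cB 0%N; rewrite expr0 mulr1; exact: le_trans.
apply: (@series_le_cvg _ _ (geometric A (`|t| * B))) => [n|n|n|].
- exact: normr_ge0.
- by apply: geometric_ge0 => //; rewrite mulr_ge0.
- rewrite /= normrM normrX exprMn mulrCA [leRHS]mulrC ler_wpM2r ?exprn_ge0//.
- by apply: is_cvg_geometric_series; rewrite ger0_norm// mulr_ge0.
Qed.

Lemma pseries_diffs_bound {R : realType} (c : R^nat) (A B : R) : 0 <= B ->
  (forall n, `|c n| <= A * B ^+ n) ->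
  forall n, `|pseries_diffs c n| <= (A * (2 * B)) * (2 * B) ^+ n.
Proof.
move=> B0 cB n; rewrite /pseries_diffs normrM ger0_norm//.
have A0 : 0 <= A by have := cB 0%N; rewrite expr0 mulr1; exact: le_trans.
rewrite -mulrA -exprS exprMn mulrCA ler_pM// -natrX ler_nat.
by rewrite ltnW// ltn_expl.
Qed.

Lemma pseries_bound {R : realType} (c : R^nat) (r : R) : 0 < r ->
  cvgn (pseries c r) -> exists A, forall n, `|c n| <= A * r^-1 ^+ n.
Proof.
move=> r0 /cvg_series_cvg_0 /cvgP /cvg_seq_bounded [M [_ /(_ (M + 1))]] /=.
rewrite ltrDl ltr01 => /(_ isT) cM; exists (M + 1) => n.
have := cM n I; rewrite /= normrM normrX (gtr0_norm r0) exprVn.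
by rewrite ler_pdivlMr// exprn_gt0.
Qed.

Lemma is_derive_pseries {R : realType} (c : R^nat) (A B t : R) : 0 < B ->
  (forall n, `|c n| <= A * B ^+ n) -> `|t| * (4 * B) < 1 ->
  is_derive t (1 : R) (fun x => limn (pseries c x))
    (limn (pseries (pseries_diffs c) t)).
Proof.
move=> B0 cB tB.
have cB1 := pseries_diffs_bound (ltW B0) cB.
have B20 : 0 < 2 * B by rewrite mulr_gt0.
have cB2 := pseries_diffs_bound (ltW B20) cB1.
have tB' : `|t| < (4 * B)^-1 by rewrite -ltr_pdivlMr ?mulr_gt0// div1r in tB.
have [K tK KB] : exists2 K, `|t| < K & K < (4 * B)^-1.
  by exists ((`|t| + (4 * B)^-1) / 2); lra.
have K0 : 0 < K by exact: le_lt_trans tK.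
have KB' : K * (4 * B) < 1 by rewrite -ltr_pdivlMr ?mulr_gt0// div1r.
have KB0 : 0 < K * B by rewrite mulr_gt0.
apply: (@pseries_snd_diffs _ _ K); rewrite ?(gtr0_norm K0)//.
- by apply: (is_cvg_pseries_bound _ cB); rewrite ?(gtr0_norm K0)//; lra.
- by apply: (is_cvg_pseries_bound _ cB1); rewrite ?(gtr0_norm K0)//; lra.
- by apply: (is_cvg_pseries_bound _ cB2); rewrite ?(gtr0_norm K0)//; lra.
Qed.

Lemma pseries_at0 {R : realType} (c : R^nat) : pseries c 0 @ \oo --> c 0%N.
Proof.
apply: cvg_near_cst; near=> n.
have n0 : (0 < n)%N by near: n; exact: nbhs_infty_gt.
rewrite /pseries /series/= -(prednK n0) big_nat_recl//= expr0 mulr1 big1_seq ?addr0//.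
by move=> i _; rewrite expr0n/= mulr0.
Unshelve. all: by end_near. Qed.

Lemma pseries_eq0 {R : realType} (c : R^nat) :
  (\forall t \near (0 : R), pseries c t @ \oo --> (0 : R)) -> forall n, c n = 0.
Proof.
move=> c0 n; elim: n c c0 => [|n IH] c c0.
  have := nbhs_singleton c0; move/(@cvg_lim _ _) => <- //.
  by apply/esym/cvg_lim => //; exact: pseries_at0.
have [e /= e0 ce] := c0.
have e20 : 0 < e / 2 by rewrite divr_gt0.
have /(pseries_bound e20) [A cA] : cvgn (pseries c (e / 2)).
  by apply: (cvgP 0); apply: ce; rewrite /ball/= sub0r normrN gtr0_norm//; lra.
set B := (e / 2)^-1 in cA.
have B0 : 0 < B by rewrite invr_gt0.
have dc0 : \forall t \near (0 : R), pseries (pseries_diffs c) t @ \oo --> (0 : R).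
  near=> t.
  have tB : `|t| * (4 * B) < 1.
    rewrite -ltr_pdivlMr ?mulr_gt0// div1r -[t]subr0 distrC.
    near: t; apply: (@nbhsx_ballx _ _ (0:R) _); rewrite ?invr_gt0 ?mulr_gt0//.
  have te : `|0 - t| < e by near: t; exact: (@nbhsx_ballx _ _ (0:R) _ e0).
  have nt : nbhs t (ball (0 : R) e).
    by apply: open_nbhs_nbhs; split; [exact: ball_open|exact: te].
  have dt := is_derive_pseries B0 cA tB.
  have cv : cvgn (pseries (pseries_diffs c) t).
    apply: (is_cvg_pseries_bound _ (pseries_diffs_bound (ltW B0) cA)).
      by rewrite mulr_ge0// ltW.
    have : 0 <= `|t| * B by rewrite mulr_ge0// ltW.
    by move: tB; lra.
  suff <- : limn (pseries (pseries_diffs c) t) = 0 by [].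
  have := @derive_val _ _ _ _ _ _ _ dt => <-.
  rewrite (@near_eq_derive _ _ _ _ (cst 0)) ?derive_cst//.
  near=> s; apply/cvg_lim => //; apply: ce.
  by near: s; exact: nt.
have /eqP := IH _ dc0; rewrite /pseries_diffs mulf_eq0 pnatr_eq0/= => /eqP.
by [].
Unshelve. all: by end_near. Qed.

Lemma is_charlier_uniq {R : realType} (x alpha : R) c1 c2 :
  is_charlier x alpha c1 -> is_charlier x alpha c2 -> c1 = c2.
Proof.
move=> h1 h2; apply/funext => n.
have := @pseries_eq0 R (fun n => c1 n / n`!%:R - c2 n / n`!%:R).
have H : \forall t \near (0 : R),
    pseries (fun n => c1 n / n`!%:R - c2 n / n`!%:R) t @ \oo --> (0 : R).
  apply: filterS2 h1 h2 => t p1 p2.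
  rewrite [X in X @ _ --> _](_ : _ = fun k => pseries (fun n => c1 n / n`!%:R) t k
      - pseries (fun n => c2 n / n`!%:R) t k); last first.
    apply/funext => k; rewrite /pseries/series/= -sumrB.
    by apply: eq_bigr => i _; rewrite mulrBl.
  by rewrite -(subrr (expR (- alpha * t) * (1 + t) `^ x)); exact: cvgB.
move=> /(_ H n) /eqP; rewrite -mulrBl mulf_eq0 invr_eq0 pnatr_eq0.
by rewrite -leqn0 leqNgt fact_gt0 orbF subr_eq0 => /eqP.
Qed.

Lemma is_charlier_ex {R : realType} (x alpha : R) : exists c, is_charlier x alpha c.
Proof.
pose step (n : nat) (q : R * R) :=
  (q.2, ((x - alpha - n%:R) * q.2 - alpha * q.1) / n.+1%:R).
pose ab n := iteri n step (0, 1).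
pose a n := (ab n).2.
have aS n : pseries_diffs a n.+1 =
    (x - alpha) * a n.+1 - n.+1%:R * a n.+1 - alpha * a n.
  by rewrite /pseries_diffs /a/= mulrCA divff ?pnatr_eq0// mulr1; ring.
have a1 : pseries_diffs a 0 = (x - alpha) * a 0%N.
  by rewrite /pseries_diffs /a/=; field.
pose B := `|x| + 2 * `|alpha| + 1.
have B1 : 1 <= B by rewrite /B lerDr addr_ge0 ?mulr_ge0.
have B0 : 0 < B by exact: lt_le_trans B1.
have abB n : `|(ab n).1| <= B ^+ n /\ `|(ab n).2| <= B ^+ n.
  elim: n => [|n [p q]]; first by rewrite /ab/= normr0 normr1 expr0.
  split; rewrite /ab/= -/(ab n).
    by rewrite (le_trans q)// ler_weXn2l.
  rewrite normrM normfV (@ger0_norm _ n.+1%:R)// ler_pdivrMr ?ltr0n//.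
  rewrite (le_trans (ler_normB _ _))// !normrM.
  have h1 : `|x - alpha - n%:R| <= `|x| + `|alpha| + n%:R.
    rewrite (le_trans (ler_normB _ _))// (@ger0_norm _ n%:R)// lerD2r.
    by rewrite (le_trans (ler_normB _ _)).
  rewrite (@le_trans _ _ ((`|x| + `|alpha| + n%:R) * B ^+ n + `|alpha| * B ^+ n))//.
    by rewrite lerD// ler_pM.
  have Bn0 : 0 <= B ^+ n by rewrite exprn_ge0// ltW.
  rewrite exprS [leRHS]mulrAC -mulrDl ler_wpM2r//.
  have nB : n%:R <= B * n%:R by rewrite ler_peMl.
  have Bxa : `|x| + 2 * `|alpha| <= B by rewrite /B lerDl.
  rewrite -natr1; lra.
have aB n : `|a n| <= 1 * B ^+ n by rewrite mul1r; have [] := abB n.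
have aB' := pseries_diffs_bound (ltW B0) aB.
pose f t := limn (pseries a t).
pose g t := limn (pseries (pseries_diffs a) t).
pose d := (4 * B)^-1.
have d0 : 0 < d by rewrite invr_gt0 mulr_gt0.
have d1 : d < 1 by rewrite invf_lt1 ?mulr_gt0//; lra.
have tB (t : R) : `|t| < d -> `|t| * (4 * B) < 1.
  by rewrite -ltr_pdivlMr ?mulr_gt0// div1r.
have cf t : `|t| < d -> pseries a t @ \oo --> f t.
  move=> /tB td; apply: (is_cvg_pseries_bound (ltW B0) aB).
  have : 0 <= `|t| * B by rewrite mulr_ge0// ltW.
  by move: td; lra.
have cg t : `|t| < d -> pseries (pseries_diffs a) t @ \oo --> g t.
  move=> /tB td; apply: (is_cvg_pseries_bound _ aB'); first lra.
  have : 0 <= `|t| * B by rewrite mulr_ge0// ltW.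
  by move: td; lra.
have ode (t : R) : `|t| < d -> (1 + t) * g t = (x - alpha) * f t - alpha * t * f t.
  move=> td.
  have E n : pseries (pseries_diffs a) t n.+1 + t * pseries (pseries_diffs a) t n
     = (x - alpha) * pseries a t n.+1 - alpha * t * pseries a t n.
    rewrite /pseries /series/=; elim: n => [|n IH].
      by rewrite !big_nat1 !big_geq// a1; ring.
    rewrite big_nat_recr//= [X in t * X]big_nat_recr//=.
    rewrite [X in (x - alpha) * X]big_nat_recr//= [X in alpha * t * X]big_nat_recr//=.
    rewrite mulrDr addrACA IH aS [pseries_diffs a n]/pseries_diffs exprS; ring.
  have L1 : (pseries (pseries_diffs a) t n.+1 + t * pseries (pseries_diffs a) t n)
      @[n --> \oo] --> g t + t * g t.
    by apply: cvgD; [rewrite cvg_shiftS|apply: cvgMl_tmp]; exact: cg.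
  have L2 : ((x - alpha) * pseries a t n.+1 - alpha * t * pseries a t n)
      @[n --> \oo] --> (x - alpha) * f t - alpha * t * f t.
    apply: cvgB; apply: cvgMl_tmp; last exact: cf.
    by rewrite (cvg_shiftS (pseries a t)); exact: cf.
  rewrite mulrDl mul1r -(cvg_lim _ L1)// -(cvg_lim _ L2)//.
  by under eq_fun do rewrite E.
pose h t := f t * expR (alpha * t) * (1 + t) `^ (- x).
have dh (t : R) : `|t| < d -> is_derive t (1 : R) h 0.
  move=> td.
  have t1 : 0 < 1 + t by move: td; rewrite ltr_norml => /andP[]; lra.
  have df : is_derive t (1 : R) f (g t) by apply: is_derive_pseries B0 aB _; exact: tB.
  have de : is_derive t (1 : R) (fun t => expR (alpha * t)) (expR (alpha * t) * alpha).
    apply: (@is_derive1_comp _ expR (fun t => alpha * t)).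
    have := is_deriveZ alpha (is_derive_id t (1 : R)).
    by rewrite [_ *: 1]mulr1.
  have dp : is_derive t (1 : R) (fun t => (1 + t) `^ (- x)) (- x * (1 + t) `^ (- x - 1) * 1).
    apply: (@is_derive1_comp _ (fun y => y `^ (- x)) (fun t => 1 + t)).
      exact: is_derive1_powR.
    by have := is_deriveD (is_derive_cst (1 : R) t (1 : R)) (is_derive_id t (1 : R)); rewrite add0r.
  have := is_deriveM (is_deriveM df de) dp; congr is_derive.
  have p1 : (1 + t) `^ (- x) = (1 + t) * (1 + t) `^ (- x - 1).
    rewrite powRD; last by apply/implyP => _; rewrite gt_eqF.
    by rewrite (powRN _ 1) powRr1 1?ltW// mulrCA divff ?mulr1// gt_eqF.
  rewrite /GRing.scale/= p1 mulr1.
  transitivity ((1 + t) `^ (- x - 1) * expR (alpha * t) *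
    ((1 + t) * g t - ((x - alpha) * f t - alpha * t * f t))); first by rewrite !fctE; ring.
  by rewrite ode// subrr mulr0.
have h0 : h 0 = 1.
  rewrite /h mulr0 expR0 addr0 powR1 !mulr1.
  by apply/cvg_lim => //; exact: pseries_at0.
have hcst u v : `|u| < d -> `|v| < d -> u <= v -> h u = h v.
  move=> ud vd uv.
  have sd s : u <= s -> s <= v -> `|s| < d.
    by move: ud vd; rewrite !ltr_norml => /andP[? ?] /andP[? ?] *; lra.
  have [||c _] := @MVT_segment _ h (fun=> 0) _ _ uv.
  - by move=> s; rewrite in_itv/= => /andP[us sv]; apply/dh/sd; exact: ltW.
  - apply: derivable_within_continuous => s; rewrite in_itv/= => /andP[us sv].
    by have [] := dh _ (sd _ us sv).
  by rewrite mul0r => /eqP; rewrite subr_eq0 => /eqP.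
have hc t : `|t| < d -> h t = 1.
  move=> td; have z : `|0 : R| < d by rewrite normr0.
  by rewrite -h0; have [t0|/ltW t0] := leP 0 t; [apply/esym|]; exact: hcst.
exists (fun n => a n * n`!%:R).
near=> t.
have td : `|t| < d by rewrite -normrN -sub0r; near: t; exact: (@nbhsx_ballx _ _ (0:R) _ d0).
have t1 : 0 < 1 + t by move: td; rewrite ltr_norml => /andP[]; lra.
have -> : expR (- alpha * t) * (1 + t) `^ x = f t.
  have := hc _ td; rewrite /h powRN mulNr expRN => ht.
  have p0 : (1 + t) `^ x != 0 by rewrite gt_eqF// powR_gt0.
  have e0 : expR (alpha * t) != 0 by rewrite gt_eqF// expR_gt0.
  by apply: (mulIf (invr_neq0 p0)); rewrite mulfK//; apply: (mulIf e0); rewrite mulVf// mulrAC.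
under eq_fun do rewrite mulfK ?pnatr_eq0 -?lt0n ?fact_gt0//.
exact: cf.
Unshelve. all: by end_near. Qed.

Lemma is_charlierP {R : realType} (x alpha : R) :
  is_charlier x alpha (fun n => charlier n x alpha).
Proof. by case: (is_charlier_ex x alpha) => c; exact: getI. Qed.

(* Main.v *)
(* The falling factorial moments of a Poisson variable are E[(X)_k] = alpha^k,
   since (j)_k / j! = 1 / (j - k)!.  Expanding (x)_{n,mu} in the basis (x)_k
   therefore gives E[(X)_{n,mu}] = phi_{n,mu}(alpha).  On the other side,
   (1 + t)^0 = 1 reduces the Charlier generating function at x = 0 to
   exp(- alpha t), so (-1)^k C_k(0; alpha) = alpha^k. *)
Require Import Defs.
From mathcomp Require Import all_boot all_order all_algebra.
From mathcomp Require Import all_classical all_reals all_analysis.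
From mathcomp Require Import measurable_realfun ring.
Set Implicit Arguments.
Unset Strict Implicit.
Unset Printing Implicit Defensive.
Import Order.TTheory GRing.Theory Num.Theory.
Import numFieldNormedType.Exports.
Local Open Scope ring_scope.

(** Uniqueness of the Charlier coefficients leaves only the generating function to check, and at
    [x = 0] it is the exponential series of [- alpha * t]. *)
Lemma charlier0 {R : realType} (n : nat) (alpha : R) :
  charlier n 0 alpha = (- alpha) ^+ n.
Proof.
suff H : is_charlier 0 alpha (fun n => (- alpha) ^+ n).
  by have := is_charlier_uniq (is_charlierP 0 alpha) H => /(congr1 (@^~ n)).
rewrite /is_charlier; near=> t; rewrite powRr0 mulr1.
rewrite [X in (X @ _ --> _)%classic](_ : _ = series (exp_coeff (- alpha * t))).
  exact: is_cvg_series_exp_coeff.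
by apply/funext => k; apply: eq_bigr => i _; rewrite /exp_coeff/= exprMn mulrAC.
Unshelve. all: by end_near. Qed.

(** Writing the argument as [i + k] avoids truncated subtraction. The induction splits off the
    leading factor: (i + k + 1)_{k+1} = (i + k + 1) (i + k)_k. *)
Lemma dffact1_addn {R : realType} (i k : nat) :
  dffact 1 k (i + k)%:R * i`!%:R = (i + k)`!%:R :> R.
Proof.
elim: k => [|k IH]; first by rewrite /dffact big_ord0 mul1r addn0.
rewrite /dffact big_ord_recl/= mul0r subr0 addnS factS natrM -IH -mulrA.
congr (_ * (_ * _)); apply: eq_bigr => j _.
by rewrite /bump/= -natr1 add1n -[j.+1%:R]natr1; ring.
Qed.

(** At a natural number the value is either 0 or a quotient of factorials. This sign lets series and
    integrals over the values of X be handled without prior integrability. *)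
Lemma dffact1_nat_ge0 {R : realType} (j k : nat) : 0 <= dffact 1 k j%:R :> R.
Proof.
have [/dffact1_small->//|kj] := ltnP j k.
have := @dffact1_addn R (j - k) k; rewrite subnK// => E.
by rewrite -(@pmulr_lge0 _ (j - k)`!%:R) ?E ?ler0n// ltr0n fact_gt0//.
Qed.

Lemma measurable_dffact {R : realType} (mu : R) (n : nat) :
  measurable_fun setT (dffact mu n).
Proof.
by apply: measurable_prod => i _; exact: measurable_funB.
Qed.

Section poisson_falling_factorial_moments.
Context {R : realType} (alpha : R) (alpha_gt0 : 0 < alpha).

Lemma cvg_series_dffact_poisson_pmf (k : nat) :
  (series (fun j => dffact 1 k j%:R * poisson_pmf alpha j) @ \oo
    --> alpha ^+ k)%classic.
Proof.
(* The terms of index below [k] vanish, and the term of index [n + k] is alpha^k exp(- alpha)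
   alpha^n / n!. *)
rewrite -(cvg_shiftn k).
have -> : (fun n => series (fun j => dffact 1 k j%:R * poisson_pmf alpha j) (n + k)%N)
    = (fun n => alpha ^+ k * expR (- alpha) * series (exp_coeff alpha) n).
  apply/funext; elim=> [|n IH].
    rewrite add0n /series/= [in RHS]big_geq// mulr0 big_nat_cond big1//.
    by move=> j /andP[/andP[_ jk] _]; rewrite dffact1_small ?mul0r.
  rewrite addSn /series/= !big_nat_recr//= mulrDr.
  congr (_ + _); first exact: IH.
  rewrite /poisson_pmf alpha_gt0 /exp_coeff/= -(dffact1_addn n k) exprD.
  have := @dffact1_addn R n k.
  have : (n + k)`!%:R != 0 :> R by rewrite pnatr_eq0 -lt0n fact_gt0.
  move=> + E; rewrite -E mulf_eq0 negb_or => /andP[d0 n0].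
  by field; rewrite d0 n0.
have aE : alpha ^+ k * expR (- alpha) * expR alpha = alpha ^+ k.
  by rewrite -mulrA (mulrC (expR _)) expRxMexpNx_1 mulr1.
apply: cvg_trans (_ : _ --> alpha ^+ k * expR (- alpha) * expR alpha)%classic _.
  by apply: cvgMl_tmp; exact: is_cvg_series_exp_coeff.
by rewrite aE.
Qed.

Lemma nneseries_dffact_poisson_pmf (k : nat) :
  (\sum_(0 <= j <oo) (dffact 1 k j%:R * poisson_pmf alpha j)%:E
    = (alpha ^+ k)%:E)%E.
Proof.
apply/cvg_lim => //.
under eq_fun do rewrite sumEFin.
by apply: cvg_EFin; [exact: nearW|exact: cvg_series_dffact_poisson_pmf].
Qed.

Context {d : measure_display} {T : measurableType d} (P : probability T R).
Context (X : {RV P >-> R}) (hX : poisson_distributed X alpha).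

Let F (j : nat) : set T := (X @^-1` [set j%:R])%classic.
Let D : set T := (\bigcup_j F j)%classic.

Let mF j : measurable (F j).
Proof. by rewrite -[F j]setTI; exact: measurable_funP. Qed.

Let mD : measurable D.
Proof. exact: bigcupT_measurable. Qed.

Let trivF : trivIset setT F.
Proof.
apply/trivIsetP => i j _ _ ij; apply/seteqP; split=> // x [/= Xi].
by rewrite /F/= Xi => /eqP; rewrite eqr_nat (negbTE ij).
Qed.

Let PF j : P (F j) = (poisson_pmf alpha j)%:E.
Proof. by rewrite -hX /pmf fineK// fin_num_measure. Qed.

(* Nothing assumes that X takes its values in the naturals: this holds almost
   surely because the Poisson masses already sum to 1 (the case k = 0 above). *)
Let PDc : P (~` D)%classic = 0%E.
Proof.
rewrite probability_setC// measure_bigcup//=.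
rewrite (_ : (\sum_(_ <oo | _) _)%E = 1%E) ?subee//.
rewrite -[RHS](nneseries_dffact_poisson_pmf 0).
rewrite (eq_eseriesl (Q := xpredT)) => [|j]; last by rewrite in_setT.
by apply: eq_eseriesr => j _; rewrite PF /dffact big_ord0 mul1r.
Qed.

Let dffact_X_ge0 k x : D x -> (0 <= (dffact 1 k (X x))%:E)%E.
Proof. by move=> [j _ /= ->]; rewrite lee_fin dffact1_nat_ge0. Qed.

Let measurable_dffact_X k (A : set T) : measurable A ->
  measurable_fun A (fun x => (dffact 1 k (X x))%:E).
Proof.
move=> mA; apply: (measurable_funS measurableT) => //.
apply/measurable_EFinP; apply: measurableT_comp => //.
exact: measurable_dffact.
Qed.

(** The integral splits over the disjoint level sets [F j], on each of which the integrand is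
    constant. *)
Let integral_D_dffact_X k :
  (\int[P]_(x in D) (dffact 1 k (X x))%:E = (alpha ^+ k)%:E)%E.
Proof.
rewrite ge0_integral_bigcup//; last 2 first.
- exact: measurable_dffact_X.
- by move=> x; exact: dffact_X_ge0.
rewrite -nneseries_dffact_poisson_pmf; apply: eq_eseriesr => j _.
rewrite (eq_integral (cst (dffact 1 k j%:R)%:E)) => [|x].
  by rewrite integral_cst// EFinM -PF.
by rewrite inE => /= ->.
Qed.

(** Outside [D] the integrand may be negative, but that set is null. On [D] it equals its absolute
    value and has a finite integral. *)
Lemma poisson_integrable_dffact1 (k : nat) :
  P.-integrable setT (fun x => (dffact 1 k (X x))%:E).
Proof.
apply/(negligible_integrable (measurableC mD)) => //.
  exact: measurable_dffact_X.
rewrite setTD setCK; apply/integrableP; split; first exact: measurable_dffact_X.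
rewrite (eq_integral (fun x => (dffact 1 k (X x))%:E)) => [|x].
  by rewrite integral_D_dffact_X ltry.
by rewrite inE => /dffact_X_ge0 /gee0_abs.
Qed.

Lemma poisson_integral_dffact1 (k : nat) :
  (\int[P]_x (dffact 1 k (X x))%:E = (alpha ^+ k)%:E)%E.
Proof.
rewrite (negligible_integral (measurableC mD))//.
  by rewrite setTD setCK integral_D_dffact_X.
exact: poisson_integrable_dffact1.
Qed.

Lemma poisson_expectation_dffact (mu : R) (n : nat) :
  ('E_P[fun w => dffact mu n (X w)] = (dbell mu n alpha)%:E)%E.
Proof.
rewrite unlock.
under eq_integral.
  move=> x _; rewrite (is_dstirling2P mu n).1 -sumEFin.
  under eq_bigr do rewrite EFinM.
  over.
(* The Stirling coefficients may have either sign, so linearity rests on the integrability of each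
   term. *)
rewrite integral_sum// => [|k]; last first.
  exact/integrableZl/poisson_integrable_dffact1.
rewrite /dbell -sumEFin; apply: eq_bigr => k _.
rewrite integralZl ?poisson_integral_dffact1//.
exact: poisson_integrable_dffact1.
Qed.

End poisson_falling_factorial_moments.

Theorem theorem9 (R : realType) (d : measure_display) (T : measurableType d)
    (P : probability T R) (X : {RV P >-> R}) (m : nat) (alpha lambda : R)
    (hm : (0 < m)%N) (halpha : 0 < alpha) (hlambda : lambda != 0)
    (hX : poisson_distributed X alpha) (n : nat) :
  ((dbell (lambda / m%:R) n alpha)%:E
     = 'E_P[fun w => dffact (lambda / m%:R) n (X w)])%E /\
  ('E_P[fun w => dffact (lambda / m%:R) n (X w)]
     = (\sum_(k < n.+1)
          charlier k 0 alpha * (-1) ^+ k * dstirling2 (lambda / m%:R) n k)%:E)%E.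
Proof.
rewrite (poisson_expectation_dffact halpha hX); split=> //; congr EFin.
apply: eq_bigr => k _.
by rewrite charlier0 -exprMn mulrN1 opprK mulrC.
Qed.
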